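(* Suppose $G=(V,E,\sigma)$ is a finite, undirected, weighted, connected, simple graph with $\sigma\in\mathbb{R}_{>0}^E$. For $1<p<\infty$ with $q:=p/(p-1)$, and $a,b\in V$, let $$\delta_p(a,b):=\begin{cases}0&\text{if }a=b,\\ \operatorname{Mod}_{p,\sigma}(\Gamma(a,b))^{-q/p}&\text{if }a\neq b.\end{cases}$$ Then, for every $1<p<\infty$, $\delta_p$ is a metric on $V$. Moreover: (a) $\lim_{p\uparrow\infty}\delta_p=d_{\mathrm{SP}}$ (pointwise on $V\times V$); (b) $\delta_2=d_{\mathrm{ER}}$; (c) for $1<p<2$, $(a,b)\mapsto\operatorname{Mod}_{p,\sigma}(\Gamma(a,b))^{-1}$ (with value $0$ when $a=b$) is a metric on $V$, and it tends to $d_{\mathrm{MC}}(a,b)$ as $p\to1$. Finally, for every $\varepsilon>0$ and every $p\in(1,\infty)$ there is a connected graph for which $\delta_p^{1+\varepsilon}$ is not a metric.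
   Context: For distinct vertices $a,b$ of a connected undirected graph $G$, $\Gamma(a,b)$ denotes the connecting family of all simple paths from $a$ to $b$, with usage function $\mathcal N(\gamma,e)=1$ if the path $\gamma$ uses the edge $e$ and $\mathcal N(\gamma,e)=0$ otherwise. For a finite family $\Gamma$ with usage matrix $\mathcal N\in\mathbb{R}_{\ge0}^{\Gamma\times E}$, $\operatorname{Adm}(\Gamma):=\{\rho\in\mathbb{R}_{\ge0}^E:\ \sum_{e}\mathcal N(\gamma,e)\rho(e)\ge1\ \text{for all }\gamma\in\Gamma\}$, and for $1\le p<\infty$, $\operatorname{Mod}_{p,\sigma}(\Gamma):=\inf_{\rho\in\operatorname{Adm}(\Gamma)}\sum_{e\in E}\sigma(e)\rho(e)^p$. The following functions take the value $0$ when $a=b$, and for $a\ne b$ are defined as follows. - $d_{\mathrm{SP}}(a,b)$ is the unweighted shortest-path distance: the minimal number of edges of a path from $a$ to $b$. - $d_{\mathrm{ER}}(a,b)$ is the effective resistance between $a$ and $b$ when $G$ is viewed as an electrical network with edge conductances $\sigma(e)$: the voltage drop $h(a)-h(b)$ necessary to pass one unit of current from $a$ to $b$, i.e. where $h:V\to\mathbb{R}$ satisfies $\sum_{y:\{x,y\}\in E}\sigma(\{x,y\})(h(x)-h(y))=\mathbf 1_{x=a}-\mathbf 1_{x=b}$ for all $x\in V$. - $d_{\mathrm{MC}}(a,b):=\mathrm{MC}(a,b)^{-1}$, where $\mathrm{MC}(a,b)$ is the minimum, over all $S\subset V$ with $a\in S$, $b\notin S$, of $\sum\sigma(e)$ taken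 over the edges $e$ with exactly one endpoint in $S$. *)

(* Defs.v *)
From HB Require Import structures.
From mathcomp Require Import all_boot all_order all_algebra.
From mathcomp Require Import all_classical all_reals all_analysis.

Set Implicit Arguments.
Unset Strict Implicit.
Unset Printing Implicit Defensive.

Import Order.TTheory GRing.Theory Num.Theory.
Import numFieldNormedType.Exports.

Local Open Scope classical_set_scope.
Local Open Scope ring_scope.

(* An edge is the set of its two endpoints. Functions on the edges (weights,
   densities, usage) are total functions on {set vertex}, and only their values
   on [edges] are constrained or used. *)
Record wgraph (R : realType) := WGraph {
  vertex : finType;
  edges : {set {set vertex}};
  weight : {set vertex} -> R;
  edges_card2 : forall e, e \in edges -> #|e| = 2%N;
  weight_gt0 : forall e, e \in edges -> 0 < weight e
}.

Section Graph.
Variables (R : realType) (G : wgraph R).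
Local Notation V := (vertex G).
Local Notation E := (edges G).
Local Notation sigma := (@weight R G).

Definition adj : rel V := fun x y => [set x; y]%SET \in E.

Definition graph_connected : Prop := forall x y : V, connect adj x y.

(* A path is the sequence of all the vertices it visits, endpoints included. *)
Definition simple_paths (a b : V) : set (seq V) :=
  [set g | if g is x :: s
           then [/\ x = a, path adj x s, last x s = b & uniq (x :: s)]
           else False].

Definition path_edges (g : seq V) : seq {set V} :=
  [seq [set xy.1; xy.2]%SET | xy <- zip g (behead g)].

Definition usage (g : seq V) (e : {set V}) : R := (e \in path_edges g)%:R.

Definition Adm (I : Type) (Gamma : set I) (N : I -> {set V} -> R) :
    set ({set V} -> R) :=
  [set rho | (forall e, e \in E -> 0 <= rho e) /\
             (forall g, Gamma g -> 1 <= \sum_(e in E) N g e * rho e)].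

Definition Mod (p : R) (I : Type) (Gamma : set I) (N : I -> {set V} -> R) : R :=
  inf [set \sum_(e in E) sigma e * rho e `^ p | rho in Adm Gamma N].

Definition Mod_conn (p : R) (a b : V) : R := Mod p (simple_paths a b) usage.

Definition delta (p : R) (a b : V) : R :=
  let q := p / (p - 1) in
  if a == b then 0 else Mod_conn p a b `^ (- (q / p)).

Definition inv_Mod_conn (p : R) (a b : V) : R :=
  if a == b then 0 else (Mod_conn p a b)^-1.

(* For a connected graph this infimum is over a nonempty set of natural
   numbers, hence it is a minimum. *)
Definition dSP (a b : V) : R :=
  if a == b then 0
  else inf [set (size (path_edges g))%:R | g in simple_paths a b].

Definition unit_current (a b : V) (h : V -> R) : Prop :=
  forall x : V, \sum_(y | adj x y) sigma [set x; y]%SET * (h x - h y)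
                = (x == a)%:R - (x == b)%:R.

(* On a connected graph such an h exists and is unique up to an additive
   constant, so the set below is a singleton and the default 0 is not used. *)
Definition dER (a b : V) : R :=
  if a == b then 0
  else xget 0 [set h a - h b | h in unit_current a b].

Definition cut_weight (S : {set V}) : R :=
  \sum_(e in E | #|e :&: S| == 1%N) sigma e.

(* The initial value of the iterated minimum is itself one of the competing
   cuts, since a != b. *)
Definition MC (a b : V) : R :=
  \big[Num.min/cut_weight [set a]%SET]_(S : {set V} | (a \in S) && (b \notin S))
     cut_weight S.

Definition dMC (a b : V) : R := if a == b then 0 else (MC a b)^-1.

End Graph.

Definition is_metric (R : realType) (T : Type) (d : T -> T -> R) : Prop :=
  [/\ forall x y, 0 <= d x y,
      forall x y, d x y = 0 <-> x = y,
      forall x y, d x y = d y x &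
      forall x y z, d x z <= d x y + d y z].

(* Main.v *)
Require Import Defs.
From mathcomp Require Import all_boot all_order all_algebra.
From mathcomp Require Import all_classical all_reals all_analysis.
From mathcomp Require Import ring lra.
Import Order.TTheory GRing.Theory Num.Theory.
Import numFieldNormedType.Exports.
Set Implicit Arguments.
Unset Strict Implicit.
Unset Printing Implicit Defensive.
Local Open Scope classical_set_scope.
Local Open Scope ring_scope.

(** Fix p > 1 and let phi t = sgn t |t|^(p-1). The energy of a density on edges
    is dual to the p-Laplacian [Lap p], and everything about the modulus follows
    from the potential h that drives one unit of p-current from a to b, that is,
    [Lap p h] is the indicator of a minus the indicator of b. With
    D = h a - h b the energy of h is D by Green's formula, so the density
    |dh| / D is admissible and has energy D^(1-p). It is optimal: raising an
    arbitrary admissible density rho to the power p costs at least the tangent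
    of t^p at |dh| / D, and the linear term is controlled because the unit flow
    phi(dh) pairs to at least 1 with rho ([flow_density]); there rho is replaced
    by the differential of its distance function to b, and Green's formula
    applies again. Hence Mod_p = D^(1-p) ([ModE]) and delta_p(a,b) = D
    ([deltaE]): delta_p is a voltage drop, exactly as for p = 2, where this is
    the definition of the effective resistance.

    Such a potential exists by Perron's method ([perron]): the supremum of
    the functions that are p-subharmonic off a and b, bounded by 1 and nonpositive
    at b is p-harmonic off a and b, and rescaling normalizes the current.

    The triangle inequality is then the comparison principle ([comparison]).
    If w drives a unit current from x to z and u from x to y, then off y one has
    Lap w <= Lap u, so that the drop of w between x and y is at most that of u;
    in the same way the drop of w between y and z is at most that of the unit
    potential from y to z. Adding the two bounds gives the claim. For 1 < p < 2
    the inverse modulus is delta_p^(p-1), a concave power of a metric.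

    Both limits are squeezes. As p grows, Mod_p lies between two constants times
    d^(-p), where d is the shortest-path distance: the constant density 1/d is
    admissible, and a shortest path alone already forces the lower bound. As p
    tends to 1, Mod_p is at most the minimum cut, by the indicators of cuts,
    and at least MC (MC / sigma(E))^(p-1), by convexity and the discrete coarea
    inequality ([coarea]).

    The exponent 1 is sharp on the path with three vertices and unit weights:
    the distances are 1, 1 and 2, and 2^(1+eps) > 1 + 1. *)

(** * The signed power and real inequalities *)

Section Phi.
Variables (R : realType) (p : R).
Hypothesis p_gt1 : 1 < p.

Definition phi (t : R) : R := Num.sg t * `|t| `^ (p - 1).

Let p1_gt0 : 0 < p - 1. Proof. by rewrite subr_gt0. Qed.
Let p_gt0 : 0 < p. Proof. exact: lt_trans ltr01 p_gt1. Qed.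

Lemma phi0 : phi 0 = 0. Proof. by rewrite /phi sgr0 mul0r. Qed.

Lemma phi1 : phi 1 = 1. Proof. by rewrite /phi sgr1 normr1 powR1 mul1r. Qed.

Lemma phiN t : phi (- t) = - phi t.
Proof. by rewrite /phi sgrN normrN mulNr. Qed.

Lemma phi_ge0 t : 0 <= t -> phi t = t `^ (p - 1).
Proof.
rewrite le_eqVlt => /predU1P[<-|t0]; first by rewrite phi0 powR0// gt_eqF.
by rewrite /phi gtr0_sg// gtr0_norm// mul1r.
Qed.

Lemma phi_mul t : phi t * t = `|t| `^ p.
Proof.
by rewrite /phi mulrAC -normrEsg mulr_powRB1.
Qed.

Lemma phi_norm t : `|phi t| = `|t| `^ (p - 1).
Proof.
have [->|t0] := eqVneq t 0; first by rewrite phi0 normr0 powR0// gt_eqF.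
by rewrite /phi normrM normr_sg t0 mul1r ger0_norm ?powR_ge0.
Qed.

Lemma phi_lt : {homo phi : s t / s < t}.
Proof.
have pos s t : 0 <= s -> s < t -> phi s < phi t.
  move=> s0 st; have t0 : 0 <= t by apply: ltW; exact: le_lt_trans st.
  by rewrite !phi_ge0// gt0_ltr_powR.
move=> s t st; have [s0|s0] := leP 0 s; first exact: pos.
have [t0|t0] := leP t 0.
  by rewrite -ltrN2 -!phiN pos ?oppr_ge0 ?ltrN2.
apply: (@lt_trans _ _ 0).
  by rewrite -oppr_gt0 -phiN -phi0 pos// oppr_gt0.
by rewrite -{1}phi0 pos.
Qed.

Lemma phi_le : {homo phi : s t / s <= t}.
Proof. exact: ltW_homo phi_lt. Qed.

Lemma phiM s t : 0 <= s -> phi (s * t) = s `^ (p - 1) * phi t.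
Proof.
rewrite le_eqVlt => /predU1P[<-|s0].
  by rewrite mul0r phi0 powR0 ?mul0r// gt_eqF.
by rewrite /phi sgrM normrM powRM// gtr0_sg// gtr0_norm//; ring.
Qed.

Lemma phi_continuous : continuous phi.
Proof.
have pos (t : R) : 0 < t -> {for t, continuous phi}.
  move=> t0; have /= : {for t, continuous (@powR R ^~ (p - 1))}.
    by apply/differentiable_continuous/derivable1_diffP/derivable_powR; rewrite in_itv/= t0.
  rewrite /prop_for /continuous_at phi_ge0 ?ltW//; apply: cvg_trans; apply: near_eq_cvg.
  by near=> s; rewrite phi_ge0// ltW//; near: s; exact: lt_nbhsr.
move=> t; have [t0|t0|->] := ltgtP t 0.
- have -> : phi = -%R \o phi \o -%R.
    by apply/funext => s /=; rewrite phiN opprK.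
  apply: continuous_comp; first exact: opp_continuous.
  apply: continuous_comp; last exact: opp_continuous.
  by apply: pos; rewrite oppr_gt0.
- exact: pos.
- rewrite /continuous_at phi0; apply/cvgr0Pnorm_lt => e e0.
  have d0 : 0 < e `^ (p - 1)^-1 by rewrite powR_gt0.
  near=> s; rewrite phi_norm.
  have -> : e = (e `^ (p - 1)^-1) `^ (p - 1).
    by rewrite -powRrM mulVf ?gt_eqF// powRr1 ?ltW.
  apply: gt0_ltr_powR; rewrite ?nnegrE ?powR_ge0//. 

Unshelve. all: by end_near. Qed.

(** Convexity of the p-th power, in the form of Young's inequality applied to
    s and t^(p-1). It turns linear lower bounds into energy lower bounds. *)
Lemma powR_tangent (s t : R) : 0 <= s -> 0 <= t ->
  t `^ p + p * t `^ (p - 1) * (s - t) <= s `^ p.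
Proof.
move=> s0 t0.
have q_gt0 : 0 < p / (p - 1) by rewrite divr_gt0.
have := @conjugate_powR R s (t `^ (p - 1)) p (p / (p - 1)) s0 (powR_ge0 _ _) p_gt0 q_gt0.
have pp : p^-1 + (p / (p - 1))^-1 = 1.
  by rewrite invf_div; field; rewrite gt_eqF.
move=> /(_ pp); rewrite -powRrM.
have -> : (p - 1) * (p / (p - 1)) = p by field; rewrite gt_eqF.
rewrite invf_div => h.
have : p * (s * t `^ (p - 1)) <= s `^ p + (p - 1) * t `^ p.
  rewrite -ler_pdivlMl// mulrDr; apply: le_trans h _.
  by rewrite le_eqVlt; apply/orP; left; apply/eqP; ring.
have := mulr_powRB1 t0 p_gt0; nra.
Qed.

End Phi.

Lemma powR_subadd (R : realType) (s x y : R) : 0 < s <= 1 -> 0 <= x -> 0 <= y ->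
  (x + y) `^ s <= x `^ s + y `^ s.
Proof.
move=> /andP[s0 s1] x0 y0.
have [xy0|xy0] := leP (x + y) 0.
  have -> : x + y = 0 by apply/eqP; rewrite eq_le xy0 addr_ge0.
  by rewrite powR0 ?gt_eqF// addr_ge0 ?powR_ge0.
have aux z : 0 <= z -> z <= x + y -> z / (x + y) * (x + y) `^ s <= z `^ s.
  move=> z0 zxy; have [->|zn0] := eqVneq z 0; first by rewrite !mul0r powR_ge0.
  have zgt0 : 0 < z by rewrite lt_neqAle eq_sym zn0.
  have {2}-> : z = z / (x + y) * (x + y) by rewrite divfK// gt_eqF.
  rewrite [leRHS]powRM ?divr_ge0 ?addr_ge0// ler_wpM2r ?powR_ge0// ger1_powR//.
  by rewrite divr_gt0//= ler_pdivrMr// mul1r.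
(* On [0, 1] a power s <= 1 dominates the identity; apply this to the shares
   x / (x + y) and y / (x + y), whose sum is 1. *)
have := aux x x0; have := aux y y0; rewrite lerDl lerDr => /(_ x0) hy /(_ y0) hx.
apply: le_trans (lerD hx hy); rewrite -mulrDl -mulrDl divff ?mul1r//.
by rewrite gt_eqF.
Qed.

Section Limits.
Variable R : realType.

Lemma powR_continuous_exponent (K : R) : 0 < K -> continuous (@powR R K).
Proof.
move=> K0 x; have -> : powR K = fun s => expR (s * ln K).
  by apply/funext => s; rewrite /powR gt_eqF.
apply: continuous_comp; last exact: continuous_expR.
exact: mulrr_continuous.
Qed.

Lemma cvg_powR_at_right (K : R) : 0 < K -> K `^ (p - 1) @[p --> 1^'+] --> (1 : R).
Proof.
move=> K0; apply: cvg_at_right_filter.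
rewrite -[X in _ --> X](powRr0 K) -(subrr 1).
apply: (continuous_comp (f := fun p : R => p - 1)); last exact: powR_continuous_exponent.
by apply: cvgB; [exact: cvg_id|exact: cvg_cst].
Qed.

Lemma cvg_powR_pinfty (K : R) : 0 < K -> K `^ (p - 1)^-1 @[p --> +oo] --> (1 : R).
Proof.
move=> K0; rewrite -[X in _ --> X](powRr0 K).
apply: (@cvg_comp _ _ _ (fun p : R => (p - 1)^-1) (powR K) _ (nbhs (0:R))); last first.
  exact: powR_continuous_exponent.
apply/(@gtr0_cvgV0 _ _ _ _ (fun p : R => p - 1)).
  by near=> p; rewrite subr_gt0; near: p; exact: nbhs_pinfty_gt.
apply/cvgryPge => A; near=> p; rewrite lerBrDr.
by near: p; apply: nbhs_pinfty_ge; rewrite num_real.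
Unshelve. all: by end_near. Qed.

End Limits.

(** * Edge sums, the p-Laplacian and Green's formula *)

Section Sums.
Variables (R : realType) (G : wgraph R).
Local Notation V := (vertex G).
Local Notation E := (edges G).
Local Notation sigma := (@weight R G).

Lemma adjC (x y : V) : adj x y = adj y x.
Proof. by rewrite /adj finset.setUC. Qed.

Lemma adj_neq (x y : V) : adj x y -> x != y.
Proof. by move=> /edges_card2; rewrite cards2; case: (x != y). Qed.

Lemma edge_adj e : e \in E -> exists x y : V, adj x y /\ e = [set x; y]%SET.
Proof.
move=> eE; have /eqP/cards2P[x [y [xy exy]]] := edges_card2 eE.
by exists x, y; rewrite /adj -exy.
Qed.

Lemma sum_edges (F : {set V} -> R) :
  \sum_(e in E) F e = 2^-1 * \sum_x \sum_(y | adj x y) F [set x; y]%SET.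
Proof.
rewrite (@pair_big_dep _ _ _ _ _ xpredT (fun x y => adj x y)
  (fun x y => F [set x; y]%SET))/=.
rewrite (partition_big (fun z : V * V => [set z.1; z.2]%SET) (mem E))//= mulr_sumr.
apply: eq_bigr => _ /[dup] /edge_adj[x [y [xy ->]]] eE.
rewrite (eq_bigr (fun=> F [set x; y]%SET)); last by move=> z /andP[_ /eqP ->].
rewrite (eq_bigl (mem [set (x, y); (y, x)]%SET)).
  rewrite sumr_const cards2.
  have -> : (x, y) != (y, x) by rewrite xpair_eqE (negbTE (adj_neq xy)).
  by rewrite -[F _ *+ _]mulr_natl mulKf// pnatr_eq0.
move=> [z t]/=; rewrite !inE !xpair_eqE; apply/idP/idP.
  move=> /andP[zt /eqP e].
  have : z \in [set x; y]%SET by rewrite -e set21.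
  have : t \in [set x; y]%SET by rewrite -e set22.
  move: zt => /adj_neq; rewrite !inE => zt /orP[]/eqP tE /orP[]/eqP zE;
    by move: zt; rewrite tE zE !eqxx ?orbT.
move=> /orP[]/andP[/eqP-> /eqP->]; first by rewrite xy eqxx.
by rewrite adjC xy finset.setUC eqxx.
Qed.

(** This is |dh| as a function of an unordered edge: for e = {x, y} each of the
    two ordered pairs contributes |h x - h y|, see [osc2]. *)
Definition osc (h : V -> R) (e : {set V}) : R :=
  2^-1 * \sum_(x in e) \sum_(y in e) `|h x - h y|.

Lemma osc2 h x y : osc h [set x; y]%SET = `|h x - h y|.
Proof.
rewrite /osc; have [<-|xy] := eqVneq x y.
  by rewrite finset.setUid !big_set1 subrr normr0 mulr0.
rewrite !big_setU1 ?inE//= !big_set1 !big_setU1 ?inE//= !big_set1.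
by rewrite !subrr !normr0 add0r addr0 [`|h y - _|]distrC; field.
Qed.

Lemma osc_ge0 h e : 0 <= osc h e.
Proof. by rewrite mulr_ge0 ?invr_ge0// sumr_ge0// => x _; rewrite sumr_ge0. Qed.

Definition Lap (p : R) (h : V -> R) (x : V) : R :=
  \sum_(y | adj x y) sigma [set x; y]%SET * phi p (h x - h y).

(** Summation by parts: the flow phi(dh) is antisymmetric, so exchanging the two
    ends of each edge symmetrizes the sum. *)
Lemma green p h g : \sum_x g x * Lap p h x =
  2^-1 * \sum_x \sum_(y | adj x y)
    sigma [set x; y]%SET * (phi p (h x - h y) * (g x - g y)).
Proof.
set f := fun x y => sigma [set x; y]%SET * phi p (h x - h y).
have -> : \sum_x g x * Lap p h x = \sum_x \sum_(y | adj x y) f x y * g x.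
  by apply: eq_bigr => x _; rewrite mulrC mulr_suml.
have e : \sum_x \sum_(y | adj x y) f x y * g y =
    - \sum_x \sum_(y | adj x y) f x y * g x.
  rewrite (exchange_big_dep xpredT)//= -sumrN; apply: eq_bigr => x _.
  rewrite -sumrN; apply: eq_big => [y|y _]; first exact: adjC.
  by rewrite /f finset.setUC -(opprB (h x)) phiN mulrN mulNr.
have -> : \sum_x \sum_(y | adj x y)
    sigma [set x; y]%SET * (phi p (h x - h y) * (g x - g y)) =
  \sum_x \sum_(y | adj x y) f x y * g x - \sum_x \sum_(y | adj x y) f x y * g y.
  rewrite -sumrB; apply: eq_bigr => x _; rewrite -sumrB; apply: eq_bigr => y _.
  by rewrite /f; ring.
by rewrite e; field.
Qed.

Lemma sum_Lap p h : \sum_x Lap p h x = 0.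
Proof.
transitivity (\sum_x 1 * Lap p h x); first by apply: eq_bigr => x _; rewrite mul1r.
rewrite (green _ _ (fun=> 1)) big1 ?mulr0// => x _; rewrite big1// => y _.
by rewrite subrr !mulr0.
Qed.

Lemma energyE p h : 1 < p ->
  \sum_x h x * Lap p h x = \sum_(e in E) sigma e * osc h e `^ p.
Proof.
move=> p1; rewrite green sum_edges; congr (_ * _).
apply: eq_bigr => x _; apply: eq_bigr => y _.
by rewrite phi_mul// osc2.
Qed.

End Sums.

(** * Simple paths and the potential of a density *)

Section Paths.
Variables (R : realType) (G : wgraph R).
Local Notation V := (vertex G).
Local Notation E := (edges G).
Local Notation sigma := (@weight R G).
Hypothesis G_conn : graph_connected G.

Lemma path_edges_cat (x : V) s1 s2 :
  path_edges (x :: s1 ++ s2) = path_edges (x :: s1) ++ path_edges (last x s1 :: s2).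
Proof.
elim: s1 x => [|y s IH] x //=.
by rewrite -[RHS]/([set x; y]%SET :: (path_edges (y :: s) ++ _)) -IH.
Qed.

Lemma mem_path_edges (s : seq V) e z :
  e \in path_edges s -> z \in e -> z \in s.
Proof.
case: s => // x s; elim: s x => [//|y s IH] x.
rewrite -[path_edges _]/([set x; y]%SET :: path_edges (y :: s)) inE.
move=> /predU1P[->|/IH h]; last by move=> /h zs; rewrite inE zs orbT.
by rewrite !inE => /orP[]/eqP->; rewrite eqxx ?orbT.
Qed.

Lemma path_edges_sub (x : V) s e :
  path (@adj R G) x s -> e \in path_edges (x :: s) -> e \in E.
Proof.
elim: s x => [//|y s IH] x /= /andP[xy ys].
rewrite -[path_edges _]/([set x; y]%SET :: path_edges (y :: s)) inE.
by move=> /predU1P[->//|]; exact: IH.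
Qed.

Lemma path_edges_uniq (s : seq V) : uniq s -> uniq (path_edges s).
Proof.
case: s => // x s; elim: s x => [//|y s IH] x /andP[xs us].
rewrite -[path_edges _]/([set x; y]%SET :: path_edges (y :: s)) cons_uniq IH// andbT.
by apply: contra xs => /mem_path_edges -> //; rewrite set21.
Qed.

Lemma size_path_edges (x : V) s : size (path_edges (x :: s)) = size s.
Proof. by rewrite size_map size_zip/=; apply/minn_idPr. Qed.

(** A simple path uses each of its edges once, so that counting edges with
    [usage] or along the path is the same. *)
Lemma sum_usage (rho : {set V} -> R) (x : V) s : path (@adj R G) x s -> uniq (x :: s) ->
  \sum_(e in E) usage (x :: s) e * rho e = \sum_(e <- path_edges (x :: s)) rho e.
Proof.
move=> xs us; rewrite big_uniq ?path_edges_uniq//=.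
under eq_bigr do rewrite mulr_natl mulrb.
rewrite -big_mkcondr; apply: eq_bigl => e.
by apply/andP/idP => [[]//|es]; rewrite (path_edges_sub xs).
Qed.

Lemma path_osc (h : V -> R) (x : V) s :
  `|h x - h (last x s)| <= \sum_(e <- path_edges (x :: s)) osc h e.
Proof.
elim: s x => [|y s IH] x; first by rewrite /= subrr normr0 big_nil.
rewrite -[path_edges _]/([set x; y]%SET :: path_edges (y :: s)) big_cons osc2.
by apply: le_trans (lerD (lexx _) (IH y)); exact: ler_distD.
Qed.

Lemma simple_paths_nonempty (a b : V) : simple_paths a b !=set0.
Proof.
have /connectP[s as_ ->] := G_conn a b.
by case: (shortenP as_) => s' as' us' _; exists (a :: s').
Qed.

(** Prepending x may close a loop; in this case the part of the path that starts
    at x is kept. This is what makes the length of a shortest simple path satisfy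
    the Lipschitz condition along edges. *)
Lemma simple_path_cons (x y b : V) w : adj x y -> simple_paths y b w ->
  exists2 w', simple_paths x b w' &
    {subset path_edges w' <= [set x; y]%SET :: path_edges w}.
Proof.
case: w => [//|z s] xy [-> {z} ys <- us].
have [xs|xs] := boolP (x \in y :: s); last first.
  by exists (x :: y :: s) => //; split=> //=; [rewrite xy|rewrite xs].
case/splitPl: xs ys us => s1 s2 s1x.
rewrite cat_path s1x => /andP[_ xs2]; rewrite -cat_cons cat_uniq.
move=> /and3P[_ /hasPn dis us2]; exists (x :: s2).
  split=> //; first by rewrite last_cat s1x.
  rewrite /= us2 andbT; apply/negP => /dis; rewrite -s1x => /negP; apply.
  exact: mem_last.
by move=> e; rewrite path_edges_cat s1x inE mem_cat => ->; rewrite !orbT.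
Qed.

(** The potential is the rho-length distance to b. Thus an admissible density
    dominates the differential of a function that drops by at least 1, which
    reduces statements on the modulus to statements on functions on vertices. *)
Lemma potential_of_density (a b : V) (rho : {set V} -> R) :
  Adm (simple_paths a b) (@usage R G) rho ->
  exists2 g : V -> R, (forall x y, adj x y -> `|g x - g y| <= rho [set x; y]%SET) &
    1 <= g a - g b.
Proof.
move=> [rho0 rho1].
pose len (w : seq V) := \sum_(e in E) usage w e * rho e.
pose g x := inf [set len w | w in simple_paths x b].
have len0 w : 0 <= len w by apply: sumr_ge0 => e eE; rewrite mulr_ge0// rho0.
have lb x : has_lbound [set len w | w in simple_paths x b].
  by exists 0 => _ [w _ <-].
have ne x : [set len w | w in simple_paths x b] !=set0.
  by have [w xw] := simple_paths_nonempty x b; exists (len w), w.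
have step x y : adj x y -> g x - g y <= rho [set x; y]%SET.
  move=> xy; rewrite lerBlDr addrC -lerBlDr; apply: lb_le_inf => // _ [w yw <-].
  rewrite lerBlDr; have [w' xw' sub] := simple_path_cons xy yw.
  apply: (@le_trans _ _ (len w')); first by apply: ge_inf => //; exists w'.
  have -> : rho [set x; y]%SET = \sum_(e in E) (e == [set x; y]%SET)%:R * rho e.
    rewrite (bigD1 [set x; y]%SET)//= eqxx mul1r big1 ?addr0// => e /andP[_ /negbTE->].
    by rewrite mul0r.
  rewrite addrC -big_split/=; apply: ler_sum => e eE.
  rewrite -mulrDl ler_wpM2r ?rho0// -natrD ler_nat.
  by have := sub e; rewrite inE; case: (e \in path_edges w') => // /(_ isT)/orP[]->//; rewrite addn1.
exists g.
  by move=> x y xy; rewrite ler_norml step// andbT lerNl opprB finset.setUC step// adjC.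
rewrite -[leLHS]subr0; apply: lerB.
  by apply: lb_le_inf => // _ [w aw <-]; exact: rho1.
apply: ge_inf => //; exists [:: b] => //.
by rewrite /len big1// => e _; rewrite mul0r.
Qed.

End Paths.

(** * Comparison principle and existence of unit potentials *)

Section Potentials.
Variables (R : realType) (G : wgraph R) (p : R).
Local Notation V := (vertex G).
Local Notation E := (edges G).
Local Notation sigma := (@weight R G).
Hypothesis G_conn : graph_connected G.
Hypothesis p_gt1 : 1 < p.

Let p1_gt0 : 0 < p - 1. Proof. by rewrite subr_gt0. Qed.
Let p_gt0 : 0 < p. Proof. exact: lt_trans ltr01 p_gt1. Qed.

Definition unit_potential (a b : V) (h : V -> R) :=
  forall x, Lap p h x = (x == a)%:R - (x == b)%:R.

Lemma connected_cross (A : {set V}) a b : a \in A -> b \notin A ->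
  exists x y, [/\ adj x y, x \in A & y \notin A].
Proof.
have /connectP[s] := G_conn a b.
elim: s a => [|y s IH] a /= => [_ -> ->//|/andP[ay ys] bE aA bA].
by have [yA|yA] := boolP (y \in A); [exact: (IH y)|exists a, y].
Qed.

(** Let A be the set where w - u exceeds its value at b. On every edge leaving A
    the flow of w is strictly larger than that of u, while the total flow out of
    A is the sum of the Laplacians over A, which is no larger for w than for u.
    Hence no edge leaves A, which contradicts connectedness when A is nonempty. *)
Lemma comparison (w u : V -> R) b :
  (forall x, x != b -> Lap p w x <= Lap p u x) ->
  forall x, w x - w b <= u x - u b.
Proof.
move=> wu x; rewrite leNgt; apply/negP => xA.
pose A := [set z | u z - u b < w z - w b]%SET.
have inA z : (z \in A) = (u z - u b < w z - w b) by rewrite inE.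
have bA : b \notin A by rewrite inA !subrr ltxx.
have [s [t [st sA tA]]] : exists s t, [/\ adj s t, s \in A & t \notin A].
  by apply: (@connected_cross _ x b) => //; rewrite inA.
(* d y z is the contribution of the oriented edge (y, z) to the difference of
   the total flows out of A. *)
pose d y z := sigma [set y; z]%SET *
  ((phi p (w y - w z) - phi p (u y - u z)) * ((y \in A)%:R - (z \in A)%:R)).
have cmp y z : y \in A -> z \notin A -> phi p (u y - u z) < phi p (w y - w z).
  rewrite !inA -leNgt => yA zA; apply: phi_lt => //; lra.
have d0 y z : adj y z -> 0 <= d y z.
  move=> yz; rewrite /d mulr_ge0 ?(ltW (weight_gt0 yz))//.
  have [yA|yA] := boolP (y \in A); have [zA|zA] := boolP (z \in A);
    rewrite ?subrr ?mulr0// ?subr0 ?sub0r.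
  - by rewrite mulr1 subr_ge0 ltW// cmp.
  - rewrite mulrN1 oppr_ge0 subr_le0 -(opprB (w z)) -(opprB (u z)) !phiN lerN2.
    by rewrite ltW// cmp.
have S0 : \sum_y \sum_(z | adj y z) d y z = 0.
  apply/eqP; rewrite eq_le; apply/andP; split; last first.
    by apply: sumr_ge0 => y _; apply: sumr_ge0 => z; exact: d0.
  have -> : \sum_y \sum_(z | adj y z) d y z =
      2 * \sum_y (y \in A)%:R * (Lap p w y - Lap p u y).
    under [X in 2 * X]eq_bigr do rewrite mulrBr.
    rewrite sumrB !green -mulrBr mulrA divff ?mul1r ?pnatr_eq0// -sumrB.
    apply: eq_bigr => y _; rewrite -sumrB; apply: eq_bigr => z _.
    by rewrite /d; ring.
  rewrite pmulr_rle0// sumr_le0// => y _.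
  have [yb|yb] := eqVneq y b; first by rewrite yb (negbTE bA) mul0r.
  by rewrite mulr_ge0_le0// subr_le0 wu.
have /(_ s isT) Ss : forall y, true -> \sum_(z | adj y z) d y z = 0.
  by apply: psumr_eq0P => // y _; apply: sumr_ge0 => z; exact: d0.
have /(_ t st) : forall z, adj s z -> d s z = 0.
  by apply: psumr_eq0P Ss => z; exact: d0.
apply/eqP; rewrite gt_eqF// /d sA (negbTE tA) subr0 mulr1.
by rewrite mulr_gt0 ?(weight_gt0 st)// subr_gt0 cmp.
Qed.

(** Perron's method needs only that t |-> phi t is continuous and monotone: the
    pointwise supremum h of the subsolutions is again a subsolution, and if its
    Laplacian were negative at x, then h could be raised slightly at x, which
    only lowers the Laplacian at the other vertices. *)
Lemma perron a b : a != b -> exists h : V -> R,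
  [/\ h a = 1, h b = 0 & forall x, x != a -> x != b -> Lap p h x = 0].
Proof.
move=> ab.
(* F u x t is the Laplacian at x of u with its value at x replaced by t. *)
pose F (u : V -> R) x t := \sum_(y | adj x y) sigma [set x; y]%SET * phi p (t - u y).
have Fcont u x : continuous (F u x).
  apply: continuous_big => [|y _ t]; first exact: add_continuous.
  apply: cvgM; first exact: cvg_cst.
  apply: (@continuous_comp _ _ _ (fun s => s - u y)); last exact: phi_continuous.
  by apply: cvgB; [exact: cvg_id|exact: cvg_cst].
have Fle u u' x t : (forall y, adj x y -> u y <= u' y) -> F u' x t <= F u x t.
  move=> uu'; apply: ler_sum => y xy; rewrite ler_wpM2l ?(ltW (weight_gt0 xy))//.
  by apply: phi_le => //; rewrite lerD2l lerN2 uu'.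
pose subsol := [set u : V -> R | [/\ forall x, u x <= 1, u b <= 0 &
  forall x, x != a -> x != b -> Lap p u x <= 0]].
pose h x := sup [set u x | u in subsol].
have s0 : subsol (fun x => (x == a)%:R).
  split=> [x||x xa xb]; first by rewrite lern1 leq_b1.
    by rewrite eq_sym (negbTE ab).
  rewrite /Lap (negbTE xa) sumr_le0// => y xy.
  rewrite mulr_ge0_le0 ?(ltW (weight_gt0 xy))// sub0r phiN oppr_le0.
  by rewrite phi_ge0 ?powR_ge0.
have ne x : [set u x | u in subsol] !=set0 by exists (x == a)%:R; exists (fun x => (x == a)%:R).
have ub x : has_ubound [set u x | u in subsol] by exists 1 => _ [u [u1 _ _] <-].
have uh u x : subsol u -> u x <= h x by move=> su; apply: ub_le_sup => //; exists u.
have h1 x : h x <= 1 by apply: ge_sup => // _ [u [u1 _ _] <-].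
have hb : h b <= 0 by apply: ge_sup => // _ [u [_ ub0 _] <-].
have hsub x : x != a -> x != b -> Lap p h x <= 0.
  move=> xa xb; rewrite leNgt; apply/negP => Lpos.
  have /nbhs_ballP[e /= e0 he] : \forall t \near h x, 0 < F h x t.
    exact: (cvgr_gt _ (Fcont h x (h x))).
  have [_ [u su <-] hu] := @sup_adherent _ _ e e0 (conj (ne x) (ub x)).
  have [_ _ /(_ x xa xb)] := su; apply/negP; rewrite -ltNge.
  apply: lt_le_trans (Fle u h x (u x) _) => [|y _]; last exact: uh.
  apply: he; rewrite /ball/= -/(h x) ger0_norm ?subr_ge0 ?uh//.
  by rewrite ltrBlDr addrC -ltrBlDr.
exists h; split.
- by apply/eqP; rewrite eq_le h1/=; have := uh _ a s0; rewrite eqxx.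
- by apply/eqP; rewrite eq_le hb/=; have := uh _ b s0; rewrite eq_sym (negbTE ab).
- move=> x xa xb; apply/eqP; rewrite eq_le hsub//= leNgt; apply/negP => Lneg.
  (* There is room to raise h at x: at a vertex where h attains its upper
     bound 1, the Laplacian is nonnegative. *)
  have hx1 : h x < 1.
    rewrite lt_neqAle h1 andbT; apply: contraTneq Lneg => hx; rewrite -leNgt.
    apply: sumr_ge0 => y xy; rewrite mulr_ge0 ?(ltW (weight_gt0 xy))//.
    by rewrite phi_ge0 ?powR_ge0// hx subr_ge0.
  have /nbhs_ballP[e /= e0 he] : \forall t \near h x, F h x t < 0.
    exact: (cvgr_lt _ (Fcont h x (h x))).
  have [d d0 [de d1]] : exists2 d : R, 0 < d & d < e /\ h x + d <= 1.
    exists (Num.min (e / 2) (1 - h x)).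
      by rewrite lt_min divr_gt0//= subr_gt0.
    split; first by rewrite gt_min ltr_pdivrMr// mulr_natr mulr2n ltrDl e0.
    by rewrite addrC -lerBrDr ge_min lexx orbT.
  pose u y := if y == x then h x + d else h y.
  have hu y : h y <= u y by rewrite /u; case: eqP => [->|//]; rewrite lerDl ltW.
  suff su : subsol u.
    by have := uh u x su; rewrite /u eqxx gerDl leNgt d0.
  split=> [y||y ya yb]; first by rewrite /u; case: eqP.
    by rewrite /u eq_sym (negbTE xb).
  apply: (@le_trans _ _ (F h y (u y))); first exact: Fle.
  rewrite /u; have [->|_] := eqVneq y x; last exact: hsub.
  apply/ltW/he; rewrite /ball/= opprD addNKr normrN gtr0_norm//.
Qed.

(** Scaling a potential by k scales its Laplacian by k^(p-1), so the solution of
    the Dirichlet problem can be normalized once its current out of a is known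
    to be positive; otherwise comparison with a constant would give h a <= h b. *)
Lemma unit_potential_exists a b : a != b -> exists h, unit_potential a b h.
Proof.
move=> ab; have [h [ha hb h0]] := perron ab.
have c0 : 0 < Lap p h a.
  rewrite ltNge; apply/negP => c0.
  have : h a - h b <= 0 - 0.
    apply: (@comparison h (fun=> 0) b) => x xb.
    rewrite [leRHS]big1; last by move=> y _; rewrite subrr phi0 mulr0.
    by have [->//|xa] := eqVneq x a; rewrite h0.
  by rewrite ha hb !subr0 ler10.
have Lb : Lap p h b = - Lap p h a.
  apply/eqP; rewrite -addr_eq0; apply/eqP.
  transitivity (\sum_x Lap p h x); last exact: sum_Lap.
  rewrite (bigD1 b)//= (bigD1 a)//= big1 ?addr0// => x /andP[xb xa].
  exact: h0.
pose k := (Lap p h a)^-1 `^ (p - 1)^-1.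
exists (fun x => k * h x) => x.
have -> : Lap p (fun x => k * h x) x = (Lap p h a)^-1 * Lap p h x.
  rewrite /Lap mulr_sumr; apply: eq_bigr => y _.
  rewrite -mulrBr phiM ?powR_ge0// /k -powRrM mulVf ?gt_eqF// powRr1 1?mulrCA//.
  by rewrite invr_ge0 ltW.
have [->|xa] := eqVneq x a; first by rewrite (negbTE ab) subr0 mulVf ?gt_eqF.
have [->|xb] := eqVneq x b; first by rewrite Lb mulrN mulVf ?gt_eqF// sub0r.
by rewrite (h0 x)// mulr0 subr0.
Qed.

End Potentials.

(** * The modulus as a voltage drop, and the metrics *)

Section Modulus.
Variables (R : realType) (G : wgraph R).
Local Notation V := (vertex G).
Local Notation E := (edges G).
Local Notation sigma := (@weight R G).
Hypothesis G_conn : graph_connected G.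

Let energy_ge0 p (rho : {set V} -> R) : 0 <= \sum_(e in E) sigma e * rho e `^ p.
Proof.
by apply: sumr_ge0 => e eE; rewrite mulr_ge0 ?powR_ge0// ltW// weight_gt0.
Qed.

Lemma Mod_le p (a b : V) rho : Adm (simple_paths a b) (@usage R G) rho ->
  Mod_conn p a b <= \sum_(e in E) sigma e * rho e `^ p.
Proof.
by move=> adm; apply: ge_inf; [exists 0 => _ [r _ <-]|exists rho].
Qed.

Lemma Adm_const (a b : V) (d : R) : 0 < d ->
  (forall w, simple_paths a b w -> d <= (size (path_edges w))%:R) ->
  Adm (simple_paths a b) (@usage R G) (fun=> d^-1).
Proof.
move=> d0 dw; split=> [e _|w aw]; first by rewrite invr_ge0 ltW.
move: aw (dw w aw); case: w => // x s [xa xs _ us] ds.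
rewrite sum_usage// big_const_seq count_predT iter_addr_0 -mulr_natl.
by rewrite ler_pdivlMr// mul1r.
Qed.

Lemma path_size_ge1 (a b : V) w : a != b -> simple_paths a b w ->
  1 <= (size (path_edges w))%:R :> R.
Proof.
move=> ab; case: w => // x [|y s] [-> _ /= ba _]; first by rewrite ba eqxx in ab.
by rewrite size_path_edges ler1n.
Qed.

Lemma Mod_ge p (a b : V) (m : R) : a != b ->
  (forall rho, Adm (simple_paths a b) (@usage R G) rho ->
     m <= \sum_(e in E) sigma e * rho e `^ p) ->
  m <= Mod_conn p a b.
Proof.
move=> ab h; apply: lb_le_inf => [|_ [rho adm <-]]; last exact: h.
have adm := Adm_const ltr01 (fun w => @path_size_ge1 a b w ab).
by eexists; exists (fun=> 1^-1).
Qed.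

Lemma sum_dipole (g : V -> R) a b :
  \sum_x g x * ((x == a)%:R - (x == b)%:R) = g a - g b.
Proof.
have one c : \sum_x g x * (x == c)%:R = g c.
  rewrite (bigD1 c)//= eqxx mulr1 big1 ?addr0// => x /negbTE ->.
  by rewrite mulr0.
by under eq_bigr do rewrite mulrBr; rewrite sumrB !one.
Qed.

Lemma unit_potential_energy p a b h : 1 < p -> unit_potential p a b h ->
  \sum_(e in E) sigma e * osc h e `^ p = h a - h b.
Proof.
move=> p1 hh; rewrite -energyE// -sum_dipole.
by apply: eq_bigr => x _; rewrite hh.
Qed.

Lemma unit_potential_drop p (a b : V) h : 1 < p -> a != b ->
  unit_potential p a b h -> 0 < h a - h b.
Proof.
move=> p1 ab hh; have p_gt0 : 0 < p by exact: lt_trans p1.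
rewrite lt_neqAle -(unit_potential_energy p1 hh) energy_ge0 andbT.
apply/eqP => /esym E0.
have := hh a; rewrite eqxx (negbTE ab) subr0 /Lap big1.
  by move=> /esym/eqP; rewrite oner_eq0.
move=> y ay.
have /(_ _ ay)/eqP : forall e, e \in E -> sigma e * osc h e `^ p = 0.
  by apply: psumr_eq0P E0 => e eE; rewrite mulr_ge0 ?powR_ge0// ltW// weight_gt0.
rewrite mulf_eq0 gt_eqF ?weight_gt0//= powR_eq0 osc2 normr_eq0 => /andP[/eqP-> _].
by rewrite phi0 mulr0.
Qed.

(** The unit flow of h decomposes into paths from a to b, so its pairing with an
    admissible density is at least 1. Instead of decomposing the flow, rho is
    bounded below by the differential of its potential g, and Green's formula
    evaluates the pairing with dg as g a - g b. *)
Lemma flow_density p a b h rho : 1 < p -> unit_potential p a b h ->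
  Adm (simple_paths a b) (@usage R G) rho ->
  1 <= \sum_(e in E) sigma e * (osc h e `^ (p - 1) * rho e).
Proof.
move=> p1 hh adm.
have [g gr /le_trans] := potential_of_density G_conn adm; apply.
rewrite -(@sum_dipole g a b) sum_edges.
rewrite (eq_bigr (fun x => g x * Lap p h x)); last by move=> x _; rewrite hh.
rewrite green ler_wpM2l ?invr_ge0//.
apply: ler_sum => x _; apply: ler_sum => y xy.
rewrite ler_wpM2l ?(ltW (weight_gt0 xy))// osc2.
by rewrite (le_trans (ler_norm _))// normrM phi_norm// ler_wpM2l ?powR_ge0// gr.
Qed.

Lemma ModE p (a b : V) h : 1 < p -> a != b -> unit_potential p a b h ->
  Mod_conn p a b = (h a - h b) `^ (1 - p).
Proof.
move=> p1 ab hh; have p_gt0 : 0 < p by exact: lt_trans p1.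
have := unit_potential_drop p1 ab hh; have := unit_potential_energy p1 hh.
set D := h a - h b; set K := D `^ (1 - p) => energyD D0.
have c0 : 0 <= D^-1 by rewrite invr_ge0 ltW.
have Kc1 : D^-1 `^ (p - 1) = K.
  by rewrite -powR_inv1 ?ltW// -powRrM; congr (_ `^ _); ring.
have Kc : D * D^-1 `^ p = K by rewrite -mulr_powRB1// mulVKf ?gt_eqF.
have energyK : \sum_(e in E) sigma e * (osc h e * D^-1) `^ p = K.
  transitivity ((\sum_(e in E) sigma e * osc h e `^ p) * D^-1 `^ p); last by rewrite energyD.
  rewrite mulr_suml; apply: eq_bigr => e _.
  by rewrite (powRM _ (osc_ge0 h e) c0) mulrA.
apply/eqP; rewrite eq_le; apply/andP; split.
  rewrite -[leRHS]energyK; apply: Mod_le; split=> [e _|[//|x s] [-> xs sb us]].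
    by rewrite mulr_ge0 ?osc_ge0.
  rewrite sum_usage// -mulr_suml ler_pdivlMr// mul1r.
  by apply: le_trans (path_osc h a s); rewrite sb ler_norm.
apply: Mod_ge => // rho adm.
(* Sum of the tangents of the p-th power at |dh| / D, evaluated at rho. *)
apply: (@le_trans _ _ (\sum_(e in E) (sigma e * (osc h e * D^-1) `^ p +
    p * (K * (sigma e * (osc h e `^ (p - 1) * rho e))
         - sigma e * (osc h e * D^-1) `^ p)))).
  rewrite big_split/= energyK -mulr_sumr sumrB energyK -mulr_sumr.
  by rewrite lerDl mulr_ge0 ?(ltW p_gt0)// subr_ge0 ler_peMr ?powR_ge0// (flow_density p1 hh adm).
apply: ler_sum => e eE.
have r0 : 0 <= rho e by case: adm => + _; exact.
have t0 : 0 <= osc h e * D^-1 by rewrite mulr_ge0 ?osc_ge0.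
have tangent := powR_tangent p1 r0 t0.
rewrite -(ler_pM2l (weight_gt0 eE)) in tangent; apply: le_trans tangent.
rewrite -(mulr_powRB1 t0 p_gt0) -Kc1 !(powRM _ (osc_ge0 h e) c0).
rewrite le_eqVlt; apply/orP; left; apply/eqP; ring.
Qed.

Lemma deltaE p (a b : V) h : 1 < p -> a != b -> unit_potential p a b h ->
  delta p a b = h a - h b.
Proof.
move=> p1 ab hh; rewrite /delta (negbTE ab) (ModE p1 ab hh) -powRrM.
have D0 := unit_potential_drop p1 ab hh.
rewrite -[RHS]powRr1 ?ltW//; congr (_ `^ _).
by field; rewrite subr_eq0 !gt_eqF// (lt_trans ltr01).
Qed.

(** The triangle inequality for distinct x, y, z compares the unit potential w
    from x to z with u, from x to y, and v, from y to z. Away from y, Lap w and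
    Lap u differ only by the sink at z, and Lap w and Lap v by the source at x. *)
Lemma delta_metric p : 1 < p -> is_metric (@delta R G p).
Proof.
move=> p1.
have dxx (x : V) : delta p x x = 0 by rewrite /delta eqxx.
have ex (a b : V) : a != b -> exists h, unit_potential p a b h.
  exact: unit_potential_exists.
have sym (x y : V) : delta p x y = delta p y x.
  have [->//|xy] := eqVneq x y.
  have [h hh] := ex _ _ xy; rewrite (deltaE p1 xy hh).
  rewrite (@deltaE _ y x (fun z => - h z)) 1?eq_sym//; first by ring.
  move=> z; rewrite -opprB -hh /Lap -sumrN; apply: eq_bigr => t _.
  by rewrite -opprD phiN mulrN.
have ge0 (x y : V) : 0 <= delta p x y.
  by rewrite /delta; case: ifP => // _; exact: powR_ge0.
split=> //.
  move=> x y; split=> [|->//]; apply: contraPeq => xy.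
  have [h hh] := ex _ _ xy; rewrite (deltaE p1 xy hh).
  by apply/eqP; rewrite gt_eqF// (unit_potential_drop p1 xy hh).
move=> x y z.
have [->|xy] := eqVneq x y; first by rewrite dxx add0r.
have [<-|yz] := eqVneq y z; first by rewrite dxx addr0.
have [->|xz] := eqVneq x z; first by rewrite dxx addr_ge0.
have [u uu] := ex _ _ xy; have [v vv] := ex _ _ yz; have [w ww] := ex _ _ xz.
rewrite (deltaE p1 xy uu) (deltaE p1 yz vv) (deltaE p1 xz ww).
have wu : w x - w y <= u x - u y.
  apply: (comparison G_conn p1) => t ty.
  by rewrite ww uu lerD2l lerN2 (negbTE ty) ler0n.
have vw : v z - v y <= w z - w y.
  apply: (comparison G_conn p1) => t ty.
  by rewrite ww vv lerD2r (negbTE ty) ler0n.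
lra.
Qed.

Lemma inv_ModE p (a b : V) : 1 < p -> inv_Mod_conn p a b = delta p a b `^ (p - 1).
Proof.
move=> p1; rewrite /inv_Mod_conn /delta; case: ifP => ab.
  by rewrite powR0// subr_eq0 gt_eqF.
rewrite -powRrM -powR_inv1; last first.
  by apply: Mod_ge => [|rho _]; rewrite ?ab.
by congr (_ `^ _); field; rewrite subr_eq0 !gt_eqF// (lt_trans ltr01).
Qed.

Lemma inv_Mod_metric p : 1 < p < 2 -> is_metric (@inv_Mod_conn R G p).
Proof.
move=> /andP[p1 p2]; have [ge0 d0 sym tri] := delta_metric p1.
have s0 : 0 < p - 1 by rewrite subr_gt0.
have iE x y := @inv_ModE p x y p1.
split=> [x y|x y|x y|x y z]; rewrite ?iE.
- exact: powR_ge0.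
- split=> [/powR_eq0_eq0/d0//|/d0 ->]; by rewrite powR0 ?gt_eqF.
- by rewrite sym.
- apply: (@le_trans _ _ ((delta p x y + delta p y z) `^ (p - 1))).
    apply: (ge0_ler_powR (ltW s0)) => //; rewrite nnegrE; [exact: ge0|exact: addr_ge0].
  by apply: powR_subadd => //; rewrite s0/= lerBlDr ltW.
Qed.

Lemma Lap2 (h : V -> R) x :
  Lap 2 h x = \sum_(y | adj x y) sigma [set x; y]%SET * (h x - h y).
Proof.
apply: eq_bigr => y _; congr (_ * _).
have -> : phi 2 (h x - h y) = Num.sg (h x - h y) * `|h x - h y|.
  by rewrite /phi (_ : 2 - 1 = 1 :> R) ?powRr1//; ring.
by rewrite -numEsg.
Qed.

Lemma delta2_dER (a b : V) : delta 2 a b = dER a b.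
Proof.
have [->|ab] := eqVneq a b; first by rewrite /delta /dER eqxx.
have p1 : 1 < 2 :> R by rewrite ltr1n.
have E_ h : unit_current a b h -> h a - h b = delta 2 a b.
  by move=> hh; rewrite (@deltaE 2 a b h)// => x; rewrite Lap2.
have [h hh] := unit_potential_exists G_conn p1 ab.
have uh : unit_current a b h by move=> x; rewrite -Lap2.
rewrite /dER (negbTE ab); case: xgetP => [_ -> [k /= uk <-]|/(_ (h a - h b)) []].
  by rewrite E_.
by exists h.
Qed.

End Modulus.

Lemma ler_powRN (R : realType) (r x y : R) : 0 <= r -> 0 < x -> x <= y ->
  y `^ (- r) <= x `^ (- r).
Proof.
move=> r0 x0 xy; have y0 := lt_le_trans x0 xy.
by rewrite !powRN lef_pV2 ?posrE ?powR_gt0// ge0_ler_powR ?nnegrE// ltW.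
Qed.

(** * The limit at infinity: shortest paths *)

Section ShortestPath.
Variables (R : realType) (G : wgraph R).
Local Notation V := (vertex G).
Local Notation E := (edges G).
Local Notation sigma := (@weight R G).
Hypothesis G_conn : graph_connected G.

Lemma dSP_attained (a b : V) : a != b -> exists2 w, simple_paths a b w &
  dSP a b = (size (path_edges w))%:R /\
  forall w', simple_paths a b w' -> dSP a b <= (size (path_edges w'))%:R.
Proof.
move=> ab; rewrite /dSP (negbTE ab).
pose P n := `[< exists2 w, simple_paths a b w & size (path_edges w) = n >].
have exP : exists n, P n.
  have [w aw] := simple_paths_nonempty G_conn a b.
  by exists (size (path_edges w)); apply/asboolP; exists w.
case: (ex_minnP exP) => n /asboolP[w aw wn] min_n.
have lb w' : simple_paths a b w' -> n%:R <= (size (path_edges w'))%:R :> R.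
  by move=> aw'; rewrite ler_nat; apply: min_n; apply/asboolP; exists w'.
have -> : inf [set (size (path_edges g))%:R | g in simple_paths a b] = n%:R :> R.
  apply/eqP; rewrite eq_le; apply/andP; split.
    by apply: ge_inf; [exists n%:R => _ [w' aw' <-]; exact: lb|exists w => //; rewrite wn].
  by apply: lb_le_inf => [|_ [w' aw' <-]]; [exists n%:R, w => //; rewrite wn|exact: lb].
by exists w => //; rewrite wn.
Qed.

Lemma weight_lower_bound : exists2 c : R, 0 < c & forall e, e \in E -> c <= sigma e.
Proof.
exists (\big[Num.min/1]_(e in E) sigma e).
  by apply: lt_bigmin => // e; exact: weight_gt0.
by move=> e eE; exact: bigmin_le_cond.
Qed.

Lemma total_weight_gt0 (a b : V) : a != b -> 0 < \sum_(e in E) sigma e.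
Proof.
move=> ab; have [x [y [xy _ _]]] : exists x y : V,
    [/\ adj x y, x \in [set a]%SET & y \notin [set a]%SET].
  by apply: (@connected_cross _ _ G_conn _ a b); rewrite inE// eq_sym.
rewrite (bigD1 [set x; y]%SET)//= ltr_pwDl ?weight_gt0//.
by apply: sumr_ge0 => e /andP[eE _]; rewrite ltW// weight_gt0.
Qed.

Lemma Mod_le_dSP p (a b : V) : a != b ->
  Mod_conn p a b <= (\sum_(e in E) sigma e) * (dSP a b)^-1 `^ p.
Proof.
move=> ab; have [w aw [dE dmin]] := dSP_attained ab.
have d0 : 0 < dSP a b.
  by rewrite dE (lt_le_trans ltr01)// (path_size_ge1 ab aw).
by rewrite mulr_suml; apply: Mod_le; exact: Adm_const.
Qed.

(** On a single shortest path the admissibility constraint and convexity already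
    force the energy: with t = 1/d the tangents of the p-th power at t sum to at
    least d t^p >= t^p. *)
Lemma Mod_ge_dSP p c (a b : V) : 1 < p -> a != b -> 0 < c ->
  (forall e, e \in E -> c <= sigma e) ->
  c * (dSP a b)^-1 `^ p <= Mod_conn p a b.
Proof.
move=> p1 ab c0 cE; have [w aw [dE _]] := dSP_attained ab.
have d1 : 1 <= dSP a b by rewrite dE (path_size_ge1 ab aw).
have t0 : 0 <= (dSP a b)^-1 by rewrite invr_ge0 (le_trans ler01).
have td : (dSP a b)^-1 * dSP a b = 1 by rewrite mulVf// gt_eqF// (lt_le_trans ltr01).
set t := (dSP a b)^-1 in t0 td *.
have U : \sum_(e in E) usage w e = dSP a b.
  rewrite dE; case: w aw {dE} => // x s [_ xs _ us].
  transitivity (\sum_(e in E) usage (x :: s) e * (1 : R)).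
    by apply: eq_bigr => e _; rewrite mulr1.
  by rewrite (sum_usage (fun=> 1))// big_const_seq count_predT iter_addr_0.
apply: Mod_ge => // rho adm; have [rho0 /(_ w aw) rho1] := adm.
apply: (@le_trans _ _ (\sum_(e in E)
    c * (t `^ p * usage w e + p * t `^ (p - 1) * (usage w e * rho e - t * usage w e)))).
  rewrite -mulr_sumr ler_pM2l// big_split/= -!mulr_sumr sumrB -mulr_sumr U td.
  apply: (@le_trans _ _ (t `^ p * dSP a b)); first by rewrite ler_peMr ?powR_ge0.
  rewrite lerDl; apply: mulr_ge0; last by rewrite subr_ge0.
  by rewrite mulr_ge0 ?powR_ge0// (le_trans ler01)// ltW.
apply: ler_sum => e eE; rewrite /usage; case: (_ \in _); last first.
  rewrite !(mulr0, mul0r, subrr, addr0) mulr_ge0 ?powR_ge0//.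
  exact: le_trans (ltW c0) (cE e eE).
apply: (@le_trans _ _ (c * rho e `^ p)); last by rewrite ler_wpM2r ?powR_ge0// cE.
rewrite !(mulr1, mul1r) ler_pM2l//.
exact (powR_tangent p1 (rho0 e eE) t0).
Qed.

Lemma delta_cvg_dSP (a b : V) : delta p a b @[p --> +oo] --> dSP a b.
Proof.
have [->|ab] := eqVneq a b.
  by under eq_cvg do rewrite /delta eqxx; rewrite /dSP eqxx; exact: cvg_cst.
have [w aw [dE dmin]] := dSP_attained ab.
have d0 : 0 < dSP a b.
  by rewrite dE (lt_le_trans ltr01)// (path_size_ge1 ab aw).
have S0 := total_weight_gt0 ab; have [c c0 cE] := weight_lower_bound.
set d := dSP a b in d0 *; set S := \sum_(e in E) sigma e in S0.
(* A modulus of the form K d^(-p) corresponds to a distance that tends to d. *)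
have bound p K : 1 < p -> 0 < K ->
    (K * d^-1 `^ p) `^ (- (p - 1)^-1) = d * (d / K) `^ (p - 1)^-1.
  move=> p1 K0.
  have -> : K * d^-1 `^ p = d^-1 `^ (p - 1) * (d / K)^-1.
    by rewrite -mulr_powRB1 ?invr_ge0 ?(ltW d0) ?(lt_trans ltr01)// invf_div; ring.
  rewrite powRM ?powR_ge0 ?invr_ge0 ?divr_ge0 ?(ltW d0) ?(ltW K0)//.
  rewrite -powRrM mulrN divff ?subr_eq0 ?gt_eqF// powR_inv1 ?invr_ge0 ?(ltW d0)// invrK.
  by rewrite -powR_inv1 ?divr_ge0 ?(ltW d0) ?(ltW K0)// -powRrM mulN1r opprK.
have lim K : 0 < K -> d * (d / K) `^ (p - 1)^-1 @[p --> +oo] --> d.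
  move=> K0; rewrite -[X in _ --> X]mulr1; apply: cvgM; first exact: cvg_cst.
  by apply: cvg_powR_pinfty; rewrite divr_gt0.
apply: (squeeze_cvgr _ (lim S S0) (lim c c0)).
near=> p; have p1 : 1 < p by near: p; exact: nbhs_pinfty_gt.
have p1V : 0 <= (p - 1)^-1 by rewrite invr_ge0 subr_ge0 ltW.
have qp : p / (p - 1) / p = (p - 1)^-1.
  by field; rewrite subr_eq0 !gt_eqF// (lt_trans ltr01).
have lo : c * d^-1 `^ p <= Mod_conn p a b by exact: Mod_ge_dSP.
have lo0 : 0 < c * d^-1 `^ p by rewrite mulr_gt0 ?powR_gt0 ?invr_gt0.
rewrite /delta (negbTE ab) qp -!bound//; apply/andP; split; apply: ler_powRN => //.
  exact: lt_le_trans lo.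
exact: Mod_le_dSP.
Unshelve. all: by end_near. Qed.

End ShortestPath.

(** * The limit at one: minimum cuts *)

Section MinCut.
Variables (R : realType) (G : wgraph R).
Local Notation V := (vertex G).
Local Notation E := (edges G).
Local Notation sigma := (@weight R G).
Hypothesis G_conn : graph_connected G.

Lemma card_edge_setI (x y : V) (S : {set V}) : x != y ->
  #|[set x; y] :&: S|%SET = ((x \in S) + (y \in S))%N.
Proof.
move=> xy; rewrite -sum1_card.
under eq_bigl do rewrite finset.in_setI.
by rewrite big_mkcondr/= big_setU1 ?inE//= big_set1; case: (x \in S); case: (y \in S).
Qed.

Lemma osc_indicator (S : {set V}) e : e \in E ->
  osc (fun x => (x \in S)%:R) e = (#|e :&: S| == 1%N)%:R :> R.
Proof.
move=> /edge_adj[x [y [xy ->]]]; rewrite osc2 card_edge_setI ?(adj_neq xy)//.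
by case: (x \in S); case: (y \in S); rewrite /= ?subrr ?subr0 ?sub0r ?normrN ?normr0 ?normr1.
Qed.

Lemma cut_weightE (S : {set V}) :
  cut_weight S = \sum_(e in E) sigma e * osc (fun x => (x \in S)%:R) e.
Proof.
rewrite /cut_weight big_mkcondr; apply: eq_bigr => e eE.
by rewrite osc_indicator//; case: (_ == _); rewrite ?mulr1 ?mulr0.
Qed.

Lemma MC_le (a b : V) (S : {set V}) : a \in S -> b \notin S ->
  MC a b <= cut_weight S.
Proof. by move=> aS bS; apply: bigmin_le_cond; rewrite aS. Qed.

Lemma cut_weight_gt0 (a b : V) (S : {set V}) : a \in S -> b \notin S ->
  0 < cut_weight S.
Proof.
move=> aS bS; have [x [y [xy xS yS]]] := connected_cross G_conn aS bS.
rewrite /cut_weight (bigD1 [set x; y]%SET)/=; last first.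
  by rewrite card_edge_setI ?(adj_neq xy)// xS (negbTE yS) andbT.
rewrite ltr_pwDl ?weight_gt0// sumr_ge0// => e /andP[/andP[eE _] _].
by rewrite ltW// weight_gt0.
Qed.

Lemma MC_gt0 (a b : V) : a != b -> 0 < MC a b.
Proof.
move=> ab; apply: lt_bigmin => [|S /andP[aS bS]]; last exact: (cut_weight_gt0 aS bS).
by apply: (@cut_weight_gt0 a b); rewrite inE// eq_sym.
Qed.

Lemma MC_ge (a b : V) (m : R) : a != b ->
  (forall S : {set V}, a \in S -> b \notin S -> m <= cut_weight S) -> m <= MC a b.
Proof.
move=> ab mS; apply: le_bigmin => [|S /andP[]]; last exact: mS.
by apply: mS; rewrite inE// eq_sym.
Qed.

(** Discrete coarea inequality: the total variation of h is the integral over t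
    of the cut weights of {h >= t}, and for h b < t <= h a these sets separate a
    from b. The proof peels off one level at a time: truncating h at its largest
    value h c below h a lowers the total variation by at least h a - h c times
    the cut of {h >= h a}, and reduces the number of vertices below a. *)
Lemma coarea (a b : V) (h : V -> R) : a != b ->
  MC a b * (h a - h b) <= \sum_(e in E) sigma e * osc h e.
Proof.
move=> ab; have MC0 := MC_gt0 ab.
have [n] := ubnP #|[set x | h x < h a]%SET|.
elim: n h => // n IH h; rewrite ltnS => hn.
have [hab|hba] := leP (h a) (h b).
  apply: (@le_trans _ _ 0); first by rewrite mulr_ge0_le0 ?subr_le0 ?(ltW MC0).
  by apply: sumr_ge0 => e eE; rewrite mulr_ge0 ?osc_ge0 ?(ltW (weight_gt0 eE)).
case: (@arg_maxP _ _ _ b (fun x => h x < h a) h hba) => c hca cmax.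
pose h' x := Num.min (h x) (h c).
pose S := [set x | h a <= h x]%SET.
have inS x : (x \in S) = (h a <= h x) by rewrite inE.
have h'S x : x \in S -> h' x = h c.
  by rewrite inS => ax; apply/min_idPr/(le_trans (ltW hca)).
have h'NS x : x \notin S -> h' x = h x.
  by rewrite inS -ltNge => ax; apply/min_idPl; exact: cmax.
have aS : a \in S by rewrite inS.
have bS : b \notin S by rewrite inS -ltNge.
have pointwise e : e \in E ->
    osc h' e + (h a - h c) * osc (fun x => (x \in S)%:R) e <= osc h e.
  move=> /edge_adj[x [y [_ ->]]]; rewrite !osc2.
  have [xS|xS] := boolP (x \in S); have [yS|yS] := boolP (y \in S);
    rewrite ?(h'S x xS) ?(h'NS x xS) ?(h'S y yS) ?(h'NS y yS);
    rewrite ?subrr ?subr0 ?sub0r ?normrN ?normr0 ?normr1 ?mulr0 ?mulr1 ?addr0//.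
  - have hx : h a <= h x by rewrite -inS.
    have hy : h y <= h c by apply: cmax; rewrite ltNge -inS.
    by rewrite !ger0_norm; lra.
  - have hy : h a <= h y by rewrite -inS.
    have hx : h x <= h c by apply: cmax; rewrite ltNge -inS.
    by rewrite !ler0_norm; lra.
have IHh' : MC a b * (h c - h b) <= \sum_(e in E) sigma e * osc h' e.
  have := IH h'; rewrite (h'S a aS) (h'NS b bS); apply.
  apply: leq_trans hn; apply: proper_card; apply/properP; split.
    apply/fintype.subsetP => x; rewrite !inE /h' gt_min ltxx orbF => /lt_trans; exact.
  by exists c; rewrite !inE// /h' gt_min ltxx.
have cutS : MC a b * (h a - h c) <= cut_weight S * (h a - h c).
  by rewrite ler_wpM2r ?MC_le// subr_ge0 ltW.
apply: (@le_trans _ _ (\sum_(e in E) sigma e *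
    (osc h' e + (h a - h c) * osc (fun x => (x \in S)%:R) e))); last first.
  by apply: ler_sum => e eE; rewrite ler_pM2l ?weight_gt0// pointwise.
have -> : \sum_(e in E) sigma e *
    (osc h' e + (h a - h c) * osc (fun x => (x \in S)%:R) e) =
    \sum_(e in E) sigma e * osc h' e + cut_weight S * (h a - h c).
  by rewrite cut_weightE mulr_suml -big_split; apply: eq_bigr => e _ /=; ring.
have -> : MC a b * (h a - h b) = MC a b * (h c - h b) + MC a b * (h a - h c) by ring.
exact: lerD.
Qed.

Lemma Mod_le_MC p (a b : V) : 1 < p -> a != b -> Mod_conn p a b <= MC a b.
Proof.
move=> p1 ab; apply: MC_ge => // S aS bS.
apply: le_trans (Mod_le p (rho := osc (fun x => (x \in S)%:R)) _) _.
  split=> [e _|[//|x s] [-> xs sb us]]; first exact: osc_ge0.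
  rewrite sum_usage//; apply: le_trans (path_osc _ a s).
  by rewrite sb aS (negbTE bS) subr0 normr1.
rewrite cut_weightE; apply: ler_sum => e eE.
rewrite osc_indicator//; case: (_ == _); rewrite ?powR1//.
by rewrite powR0// gt_eqF// (lt_trans ltr01).
Qed.

(** Jensen's inequality: an admissible density has total weighted mass at least
    MC, by [coarea] for its potential, and for this mass the constant t = MC / sigma(E)
    has the least p-energy. *)
Lemma Mod_ge_MC p (a b : V) : 1 < p -> a != b ->
  MC a b * (MC a b / \sum_(e in E) sigma e) `^ (p - 1) <= Mod_conn p a b.
Proof.
move=> p1 ab; have MC0 := MC_gt0 ab; have S0 := total_weight_gt0 G_conn ab.
have p0 : 0 < p by exact: lt_trans p1.
set S := \sum_(e in E) sigma e in S0 *; set t := MC a b / S.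
have t0 : 0 <= t by rewrite divr_ge0 ?ltW.
have tS : t * S = MC a b by rewrite divfK// gt_eqF.
apply: Mod_ge => // rho adm; have [rho0 _] := adm.
have rhoMC : MC a b <= \sum_(e in E) sigma e * rho e.
  have [g gr gab] := potential_of_density G_conn adm.
  apply: (@le_trans _ _ (MC a b * (g a - g b))); first by rewrite ler_peMr ?(ltW MC0).
  apply: le_trans (coarea g ab) _; apply: ler_sum => e eE.
  rewrite ler_pM2l ?weight_gt0//.
  by have [x [y [xy ->]]] := edge_adj eE; rewrite osc2 gr.
apply: (@le_trans _ _ (\sum_(e in E)
    (sigma e * t `^ p + p * t `^ (p - 1) * (sigma e * rho e - t * sigma e)))).
  rewrite big_split/= -mulr_suml -mulr_sumr sumrB -mulr_sumr -/S tS.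
  rewrite -(mulr_powRB1 t0 p0) mulrA [S * t]mulrC tS lerDl.
  by apply: mulr_ge0; rewrite ?subr_ge0// mulr_ge0 ?powR_ge0// ltW.
apply: ler_sum => e eE.
have tangent := powR_tangent p1 (rho0 e eE) t0.
rewrite -(ler_pM2l (weight_gt0 eE)) in tangent; apply: le_trans tangent.
by rewrite le_eqVlt; apply/orP; left; apply/eqP; ring.
Qed.

Lemma inv_Mod_cvg_dMC (a b : V) : inv_Mod_conn p a b @[p --> 1^'+] --> dMC a b.
Proof.
have [->|ab] := eqVneq a b.
  by under eq_cvg do rewrite /inv_Mod_conn eqxx; rewrite /dMC eqxx; exact: cvg_cst.
rewrite /dMC (negbTE ab).
have MC0 := MC_gt0 ab; have S0 := total_weight_gt0 G_conn ab.
set S := \sum_(e in E) sigma e in S0.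
have lim : (MC a b)^-1 * (S / MC a b) `^ (p - 1) @[p --> 1^'+] --> (MC a b)^-1.
  rewrite -[X in _ --> X]mulr1; apply: cvgM; first exact: cvg_cst.
  by apply: cvg_powR_at_right; rewrite divr_gt0.
apply: (squeeze_cvgr _ (cvg_cst _) lim).
near=> p; have p1 : 1 < p by near: p; exact: nbhs_right_gt.
have lo := Mod_ge_MC p1 ab.
have lo0 : 0 < MC a b * (MC a b / S) `^ (p - 1).
  by rewrite mulr_gt0// powR_gt0// divr_gt0.
rewrite /inv_Mod_conn (negbTE ab); apply/andP; split.
  by rewrite lef_pV2 ?posrE ?Mod_le_MC// (lt_le_trans lo0).
have -> : (MC a b)^-1 * (S / MC a b) `^ (p - 1) =
    (MC a b * (MC a b / S) `^ (p - 1))^-1.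
  rewrite invfM; congr (_ * _); rewrite -[S / _]invf_div.
  have t0 : 0 <= MC a b / S by rewrite divr_ge0 ?(ltW MC0) ?(ltW S0).
  by rewrite -(powR_inv1 t0) -powRrM mulN1r powRN.
by rewrite lef_pV2 ?posrE// (lt_le_trans lo0).
Unshelve. all: by end_near. Qed.

End MinCut.

(** * Sharpness of the exponent: the path with three vertices *)

Section Path3.
Variable R : realType.

Definition mid : 'I_3 := Ordinal (isT : (1 < 3)%N).

Definition path3_edges : {set {set 'I_3}} :=
  [set e : {set 'I_3} | (#|e| == 2%N) && (mid \in e)]%SET.

Lemma path3_card2 (e : {set 'I_3}) : e \in path3_edges -> #|e| = 2%N.
Proof. by rewrite inE => /andP[/eqP]. Qed.

Definition path3 : wgraph R :=
  @WGraph R 'I_3 path3_edges (fun=> 1) path3_card2 (fun _ _ => ltr01).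

Lemma path3_adj (x y : vertex path3) :
  adj x y = (x != y) && ((x == mid) || (y == mid)).
Proof. by rewrite /adj inE cards2 !inE ![mid == _]eq_sym; case: (x != y). Qed.

Lemma path3_connected : graph_connected path3.
Proof.
have to_mid (x : vertex path3) : connect (@adj R path3) x mid.
  have [->|xm] := eqVneq x mid; first exact: connect0.
  by apply: connect1; rewrite path3_adj xm eqxx orbT.
have from_mid (x : vertex path3) : connect (@adj R path3) mid x.
  have [->|xm] := eqVneq x mid; first exact: connect0.
  by apply: connect1; rewrite path3_adj eq_sym xm eqxx.
by move=> x y; exact: connect_trans (to_mid x) (from_mid y).
Qed.

Lemma path3_Lap p (h : 'I_3 -> R) x : Lap (G := path3) p h x =
  if x == mid then phi p (h mid - h ord0) + phi p (h mid - h ord_max)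
  else phi p (h x - h mid).
Proof.
rewrite /Lap big_mkcond/= !big_ord_recl big_ord0 !path3_adj.
have -> : lift ord0 ord0 = mid :> 'I_3 by exact: val_inj.
have -> : lift ord0 (lift ord0 ord0) = ord_max :> 'I_3 by exact: val_inj.
have [->|xm] := eqVneq x mid; first by rewrite /= !mul1r add0r addr0.
by rewrite /= !andbF !mul1r !addr0 add0r.
Qed.

Lemma ord3P (P : 'I_3 -> Prop) : P ord0 -> P mid -> P ord_max -> forall x, P x.
Proof.
move=> P0 P1 P2 [[|[|[|//]]] lt_x].
- by rewrite (_ : Ordinal lt_x = ord0)//; exact: val_inj.
- by rewrite (_ : Ordinal lt_x = mid)//; exact: val_inj.
- by rewrite (_ : Ordinal lt_x = ord_max)//; exact: val_inj.
Qed.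

Lemma path3_delta p : 1 < p -> [/\ delta (G := path3) p ord0 mid = 1,
  delta (G := path3) p mid ord_max = 1 & delta (G := path3) p ord0 ord_max = 2].
Proof.
move=> p1; pose pot (u v w : R) (x : 'I_3) : R :=
  if x == ord0 then u else if x == mid then v else w.
have simp := (@phi0 R p, @phi1 R p, @phiN R p).
split.
- rewrite (@deltaE _ path3 path3_connected p ord0 mid (pot 1 0 0))//.
    by rewrite /pot/= subr0.
  apply: ord3P; rewrite path3_Lap /pot/= ?subrr ?subr0 ?sub0r ?simp ?addr0//.
- rewrite (@deltaE _ path3 path3_connected p mid ord_max (pot 1 1 0))//.
    by rewrite /pot/= subr0.
  apply: ord3P; rewrite path3_Lap /pot/= ?subrr ?subr0 ?sub0r ?simp ?add0r//.
- rewrite (@deltaE _ path3 path3_connected p ord0 ord_max (pot 2 1 0))//.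
    by rewrite /pot/= subr0.
  have e1 : 2 - 1 = 1 :> R by ring.
  have e2 : 1 - 2 = -1 :> R by ring.
  apply: ord3P; rewrite path3_Lap /pot/= ?e1 ?e2 ?subrr ?subr0 ?sub0r ?simp ?addNr//.
Qed.

Lemma path3_not_metric eps p : 0 < eps -> 1 < p ->
  ~ is_metric (fun a b : vertex path3 => delta p a b `^ (1 + eps)).
Proof.
move=> eps0 p1 [_ _ _ /(_ ord0 mid ord_max)].
have [-> -> ->] := path3_delta p1.
apply/negP; rewrite powR1 -ltNge powRD ?powRr1//; last by rewrite pnatr_eq0 implybT.
rewrite ltr_pMr//.
have := @gt0_ltr_powR R eps eps0 1 2; rewrite powR1; apply; rewrite ?nnegrE//.
by rewrite ltr1n.
Qed.

End Path3.

Theorem theorem6p2 (R : realType) :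
  (forall G : wgraph R, graph_connected G ->
    [/\ forall p : R, 1 < p -> is_metric (@delta R G p),
        forall a b : vertex G, delta p a b @[p --> +oo] --> dSP a b,
        forall a b : vertex G, delta 2 a b = dER a b &
        (forall p : R, 1 < p < 2 -> is_metric (@inv_Mod_conn R G p)) /\
        (forall a b : vertex G,
           inv_Mod_conn p a b @[p --> 1^'+] --> dMC a b)]) /\
  (forall eps p : R, 0 < eps -> 1 < p ->
    exists2 G : wgraph R, graph_connected G &
      ~ is_metric (fun a b : vertex G => delta p a b `^ (1 + eps))).
Proof.
split=> [G G_conn|eps p eps0 p1].
  split; [exact: delta_metric|exact: delta_cvg_dSP|exact: delta2_dER|].
  by split; [exact: inv_Mod_metric|exact: inv_Mod_cvg_dMC].
by exists (path3 R); [exact: path3_connected|exact: path3_not_metric].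
Qed.
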